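(* Let $\lambda$ be a partition. For a cell $(i,j)\in\lambda$ let $$w(i,j)=\max\{\,i'-i+j'-j : (i',j')\in\lambda,\ i\le i',\ j\le j'\,\}.$$ Then the worst case complexity $W(\lambda)$ of the Novelli--Pak--Stoyanovskii algorithm on $\lambda$ satisfies $$W(\lambda)=\sum_{(i,j)\in\lambda} w(i,j).$$
   Context: A partition $\lambda$ of $n$ is a weakly decreasing sequence $\lambda_1\ge\dots\ge\lambda_k>0$ of positive integers with sum $|\lambda|=n$; its length is $l(\lambda)=k$. It is identified with its Young diagram $\{(i,j):1\le i\le l(\lambda),\ 1\le j\le\lambda_i\}$, whose elements are called cells ($i$ is the row, $j$ the column). A cell $(i,j)$ is a corner of $\lambda$ if neither $(i+1,j)$ nor $(i,j+1)$ belongs to $\lambda$ (i.e. it has hook length $1$). A tableau of shape $\lambda$ is a bijection $T:\lambda\to\{1,\dots,n\}$; the set of tableaux is $\mathrm{T}(\lambda)$. The (column-wise) Novelli--Pak--Stoyanovskii (NPS) algorithm applied to $T\in \mathrm{T}(\lambda)$: order cells by $(i,j)\preceq(i',j')$ if $j<j'$, or $j=j'$ and $i\le i'$. Let $(i_1,j_1)\succ(i_2,j_2)\succ\dots\succ(i_n,j_n)$ be the cells of $\lambda$ in decreasing order, put $k_r=T(i_r,j_r)$ (entries of the initial tableau $T$) and $T_0=T$. For $r=1,\dots,n$ the tableau $T_r$ is obtained from $T_{r-1}$ as follows. Start with the current tableau equal to $T_{r-1}$ and repeat: let $(i,j)$ be the cell of the current tableau containing $k_r$. If $(i,j)$ is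 a corner of $\lambda$, stop. Otherwise let $m$ be the minimum of the entries of the current tableau in the cells of $\lambda\cap\{(i+1,j),(i,j+1)\}$. If $k_r<m$, stop. If $m<k_r$, exchange the entries $m$ and $k_r$ (this counts as one exchange) and repeat. When stopped, $T_r$ is the current tableau. $n(T)$ denotes the total number of exchanges performed during the construction of $T_1,\dots,T_n$. The worst case complexity is $W(\lambda)=\max_{T\in \mathrm{T}(\lambda)}n(T)$. *)

(* Defs.v *)
From mathcomp Require Import all_boot fingroup perm.

Set Implicit Arguments.
Unset Strict Implicit.
Unset Printing Implicit Defensive.

Definition is_partition (la : seq nat) : bool := sorted geq la && (0 \notin la).

(* Rows and columns are numbered from 1; parts of [la] are stored from 0. *)
Definition in_diagram (la : seq nat) (i j : nat) : bool :=
  (0 < i <= size la) && (0 < j <= nth 0 la i.-1).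

(* No cell is lost: a row index is at most [size la], and a column index at   *)
(* most [sumn la], the size of the partition.                                 *)
Definition cell (la : seq nat) : predArgType :=
  {c : 'I_(size la).+1 * 'I_(sumn la).+1 | in_diagram la c.1 c.2}.

Section NPS.

Variable la : seq nat.

Implicit Types (c d : cell la) (k : 'I_(sumn la).+1).

Definition row c : nat := (val c).1.
Definition col c : nat := (val c).2.

Definition filling : predArgType := {ffun cell la -> 'I_(sumn la).+1}.

Implicit Types T : filling.

(* [T] is a bijection from the diagram onto {1, ..., |la|}. *)
Definition is_tableau T : bool :=
  injectiveb T && (T @: [set: cell la] == [set k : 'I_(sumn la).+1 | 0 < k]).

Definition cell_le c d : bool :=
  (col c < col d) || ((col c == col d) && (row c <= row d)).

Definition cells_decreasing : seq (cell la) :=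
  sort (fun c d => cell_le d c) (enum (cell la)).

Definition next_cells c : {set cell la} :=
  [set d | ((row d == (row c).+1) && (col d == col c))
        || ((row d == row c) && (col d == (col c).+1))].

Definition exchange (k m : 'I_(sumn la).+1) T : filling :=
  [ffun c => tperm k m (T c)].

(* One pass through the loop moving the entry [k]: [None] means "stop".  The  *)
(* inner [pick] fails exactly when [c] is a corner; otherwise its result only *)
(* witnesses that [next_cells c] is nonempty, as [arg min] requires.          *)
Definition step k T : option filling :=
  if [pick c | T c == k] is Some c then
    if [pick d in next_cells c] is Some d0 then
      let m := T [arg min_(d < d0 in next_cells c) T d] in
      if m < k then Some (exchange k m T) else None
    else None
  else None.

(* Final filling and number of exchanges, with at most [fuel] exchanges. *)
Fixpoint slide (fuel : nat) k T : filling * nat :=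
  if fuel is fuel'.+1 then
    if step k T is Some T' then
      let: (T'', e) := slide fuel' k T' in (T'', e.+1)
    else (T, 0)
  else (T, 0).

(* The fuel is never exhausted early: see [slide_stop] below.                 *)
(* The entry moved at the round of [c] is read in the initial tableau [T].    *)
Definition nps T : filling * nat :=
  foldl (fun (S : filling * nat) c =>
           let: (T', e) := slide #|{: cell la}| (T c) S.1 in (T', S.2 + e))
        (T, 0) cells_decreasing.

Definition exchanges T : nat := (nps T).2.

Definition worst_case : nat := \max_(T : filling | is_tableau T) exchanges T.

Definition w c : nat :=
  \max_(d : cell la | (row c <= row d) && (col c <= col d))
     (row d - row c + (col d - col c)).

Lemma exchange_tableau (k m : 'I_(sumn la).+1) T :
  0 < k -> 0 < m -> is_tableau T -> is_tableau (exchange k m T).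
Proof.
move=> k0 m0 /andP[/injectiveP injT /eqP imT]; apply/andP; split.
  by apply/injectiveP => c d; rewrite !ffunE => /perm_inj /injT.
apply/eqP/setP => x; rewrite inE; apply/imsetP/idP.
  case=> c _ ->; rewrite ffunE.
  have := imset_f T (in_setT c); rewrite imT inE => Tc0.
  by case: tpermP.
move=> x0; have: tperm k m x \in T @: [set: cell la].
  by rewrite imT inE; case: tpermP.
by case/imsetP => c _ Ec; exists c; rewrite // ffunE -Ec tpermK.
Qed.

Lemma step_tableau k T T' : is_tableau T -> step k T = Some T' -> is_tableau T'.
Proof.
move=> tT; rewrite /step; case: pickP => // c /eqP <-.
case: pickP => // d0 _; case: ifP => // _ [<-].
have T_gt0 d : 0 < T d.
  by case/andP: tT => _ /eqP imT; have := imset_f T (in_setT d); rewrite imT inE.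
by apply: exchange_tableau.
Qed.

Lemma slide_tableau fuel k T : is_tableau T -> is_tableau (slide fuel k T).1.
Proof.
elim: fuel T => [|f IH] T tT //=; case E: (step k T) => [T'|] //=.
have := IH _ (step_tableau tT E); by case: (slide f k T').
Qed.

Lemma next_rowcol c d : d \in next_cells c -> row c + col c < row d + col d.
Proof.
by rewrite inE => /orP[] /andP[/eqP -> /eqP ->]; rewrite ?addSn ?addnS.
Qed.

Lemma slide_stop_rec fuel c T : is_tableau T ->
  #|[set d | row c + col c < row d + col d]| <= fuel ->
  step (T c) (slide fuel (T c) T).1 = None.
Proof.
have pickT (S : filling) x : is_tableau S -> [pick y | S y == S x] = Some x.
  case/andP=> /injectiveP injS _; case: pickP => [y /eqP /injS -> //|].
  by move/(_ x); rewrite eqxx.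
elim: fuel c T => [|f IH] c T tT; last first.
  move=> le_f /=; case E: (step (T c) T) => [T'|] //=.
  have tT' := step_tableau tT E.
  move: E; rewrite /step pickT //; case: pickP => // d0 d0c.
  case: arg_minnP => // d dc _; case: ifP => // _ [ET'].
  have Ed : T c = T' d by rewrite -ET' ffunE tpermR.
  have := IH d T' tT'; rewrite -Ed; case: (slide f (T c) T') => T'' e; apply.
  rewrite -ltnS; apply: leq_trans le_f; apply: proper_card.
  have ltcd := next_rowcol dc; apply/properP; split.
    by apply/subsetP => x; rewrite !inE; apply: ltn_trans.
  by exists d; rewrite !inE ?ltnn.
rewrite leqn0 cards_eq0 => /eqP E0 /=; rewrite /step pickT //.
case: pickP => // d0 /next_rowcol ltcd.
by have := in_set0 d0; rewrite -E0 inE ltcd.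
Qed.

Lemma slide_stop c T : is_tableau T ->
  step (T c) (slide #|{: cell la}| (T c) T).1 = None.
Proof. by move=> tT; apply: slide_stop_rec => //; apply: max_card. Qed.

End NPS.

(* Main.v *)
(** Every exchange moves the entry [k_r] one cell down or to the right, so the
    round of [c] makes at most [w c] exchanges. A single tableau attains all
    these bounds: fix an injective [key] on cells for which a larger
    [row + col] means a larger key, let [target c] be the largest key of a cell
    weakly south-east of [c], and number the cells by decreasing target,
    equal targets in processing order. Then the entry sitting in a cell always
    comes from a cell with the same target: targets decrease towards the
    south-east, so at [y] the smaller neighbour is one that still has the target
    of [y], and it is smaller than the moving entry, the last one so far with
    that target. Hence this entry runs all the way to the farthest cell. *)
Require Import Defs.
From mathcomp Require Import all_boot fingroup perm.
From mathcomp Require Import zify.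

Set Implicit Arguments.
Unset Strict Implicit.
Unset Printing Implicit Defensive.

(** * Counting the cells of the diagram *)

Lemma leq_nth_sumn (s : seq nat) i : nth 0 s i <= sumn s.
Proof.
elim: s i => [|a s IH] [|i] //=; first exact: leq_addr.
exact: leq_trans (IH i) (leq_addl _ _).
Qed.

Lemma card_ord_interval n m : n <= m -> #|[set j : 'I_m.+1 | 0 < j <= n]| = n.
Proof.
move=> lenm; have inj : injective (fun j : 'I_n => inord j.+1 : 'I_m.+1).
  move=> j k /(congr1 val) /=; have kn := ltn_ord k; have jn := ltn_ord j.
  by rewrite !inordK; [case=> /val_inj | lia..].
rewrite -[RHS]card_ord -(card_imset _ inj); apply: eq_card => j.
rewrite inE; apply/idP/imsetP => [/andP[j0 jn]|[k _ ->]].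
  have jn' : j.-1 < n by case: (val j) j0 jn.
  by exists (Ordinal jn') => //; apply: val_inj; rewrite /= prednK // inordK.
by have kn := ltn_ord k; rewrite inordK; lia.
Qed.

Section Cells.

Variable la : seq nat.

Implicit Types (c d x y z : cell la) (T U : filling la) (s : seq (cell la)).

Lemma card_cell : #|{: cell la}| = sumn la.
Proof.
rewrite card_sig -sum1_card
  -(pair_big_dep xpredT (fun i j => in_diagram la (val i) (val j)) (fun _ _ => 1)) /=.
(* Rows are numbered from 1, so index 0 contributes no cell; the remaining indices match the parts
   of [la]. *)
rewrite big_ord_recl big_pred0 // add0n.
rewrite [RHS]sumnE (big_nth 0) big_mkord; apply: eq_bigr => i _.
rewrite sum1_card -[RHS](card_ord_interval (leq_nth_sumn la i)).
by apply: eq_card => j; rewrite !inE /in_diagram lift0 /= ltn_ord.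
Qed.

(** * Domination, the processing order and the weight *)

Lemma cell_inj c d : row c = row d -> col c = col d -> c = d.
Proof.
move=> Er Ec; apply: val_inj; move: Er Ec; rewrite /row /col.
case: (val c) (val d) => [i j] [i' j'] /= Ei Ej.
by congr pair; apply: val_inj.
Qed.

Definition dominated c d := (row c <= row d) && (col c <= col d).

Lemma dominated_refl c : dominated c c.
Proof. by rewrite /dominated !leqnn. Qed.

Lemma dominated_trans d c x : dominated c d -> dominated d x -> dominated c x.
Proof.
by move=> /andP[r1 c1] /andP[r2 c2]; rewrite /dominated (leq_trans r1) ?(leq_trans c1).
Qed.

Lemma cell_le_refl c : cell_le c c.
Proof. by rewrite /cell_le eqxx leqnn orbT. Qed.

Lemma cell_le_trans : transitive (@cell_le la).
Proof.
move=> d c x; rewrite /cell_le.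
case: (ltngtP (col c) (col d)) => //= [lt1 _|->].
  by case/orP => [/(ltn_trans lt1) -> //|/andP[/eqP <- _]]; rewrite lt1.
move=> le1 /orP[-> //|/andP[-> /(leq_trans le1) ->]]; exact: orbT.
Qed.

Lemma cell_le_total : total (@cell_le la).
Proof.
by move=> c d; rewrite /cell_le; case: (ltngtP (col c) (col d)) => //= _; apply: leq_total.
Qed.

Lemma cell_le_anti : antisymmetric (@cell_le la).
Proof.
move=> c d; rewrite /cell_le; case: (ltngtP (col c) (col d)) => //= Ec.
by rewrite -eqn_leq => /eqP Er; apply: cell_inj.
Qed.

Lemma dominated_le c d : dominated c d -> cell_le c d.
Proof.
by rewrite /dominated /cell_le; case: (ltngtP (col c) (col d)) => //= _; rewrite ?andbF ?andbT.
Qed.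

Lemma next_dominated c d : d \in next_cells c -> dominated c d.
Proof.
by rewrite inE /dominated => /orP[] /andP[/eqP -> /eqP ->]; rewrite leqnn leqnSn.
Qed.

Lemma next_neq c d : d \in next_cells c -> d != c.
Proof.
by move=> /next_rowcol lt; apply: contraTneq lt => ->; rewrite ltnn.
Qed.

(** The additive form avoids truncated subtraction. Together with [w_leq] it characterises [w c] as
    a least upper bound, and later proofs never unfold the maximum. *)
Lemma dominated_w c d : dominated c d -> row d + col d <= w c + (row c + col c).
Proof.
move=> cd; have : row d - row c + (col d - col c) <= w c by exact: leq_bigmax_cond.
by move: cd; rewrite /dominated; lia.
Qed.

Lemma w_leq c n :
  (forall d, dominated c d -> row d + col d <= n + (row c + col c)) -> w c <= n.
Proof.
by move=> le_n; apply/bigmax_leqP => d cd; have := le_n d cd; move: cd; lia.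
Qed.

Lemma next_weight c d : d \in next_cells c -> w d < w c.
Proof.
move=> dc; have cd := next_dominated dc; have lt := next_rowcol dc.
have := dominated_w cd.
suff: w d <= w c - (row d + col d - (row c + col c)) by lia.
apply: w_leq => x /(dominated_trans cd) /dominated_w; lia.
Qed.

(** * Keys and targets *)

Definition key d := (row d + col d) * (sumn la).+1 + col d.

(** The base [(sumn la).+1] exceeds every column, so [key] compares cells lexicographically: first
    by [row + col], then by [col]. *)
Lemma key_rowcol c d : key c <= key d -> row c + col c <= row d + col d.
Proof.
have := ltn_ord (val c).2; have := ltn_ord (val d).2.
rewrite -/(col c) -/(col d) /key; nia.
Qed.

Lemma key_inj : injective key.
Proof.
move=> c d E.
have lecd : row c + col c <= row d + col d by apply: key_rowcol; rewrite E.
have ledc : row d + col d <= row c + col c by apply: key_rowcol; rewrite E.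
have Erc : row c + col c = row d + col d by lia.
by move: E; rewrite /key Erc => /addnI Ec; apply: cell_inj; lia.
Qed.

Definition target c := \max_(d | dominated c d) key d.

Lemma target_key c : exists2 d, dominated c d & target c = key d.
Proof.
have pos : 0 < #|[pred d | dominated c d]|.
  by apply/card_gt0P; exists c; rewrite inE dominated_refl.
by have [d cd E] := eq_bigmax_cond key pos; exists d.
Qed.

Lemma target_dominated c d : dominated c d -> target d <= target c.
Proof.
move=> cd; apply/bigmax_leqP => x dx.
exact/leq_bigmax_cond/dominated_trans/dx.
Qed.

(** A largest key forces a largest [row + col], so the cell realising the target is also a farthest
    one. *)
Lemma w_target c d : dominated c d -> target c = key d ->
  w c + (row c + col c) = row d + col d.
Proof.
move=> cd E; have := dominated_w cd.
suff: w c <= row d + col d - (row c + col c) by move: cd; rewrite /dominated; lia.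
apply: w_leq => x cx; have: key x <= key d by rewrite -E; apply: leq_bigmax_cond.
by move/key_rowcol; move: cx; rewrite /dominated; lia.
Qed.

(** * The worst filling *)

Definition before c d :=
  (target d < target c) || (target c == target d) && cell_le d c.

Lemma before_refl c : before c c.
Proof. by rewrite /before eqxx cell_le_refl orbT. Qed.

Lemma before_anti c d : before c d -> before d c -> c = d.
Proof.
by rewrite /before; case: ltngtP => //= _ cd dc; apply: cell_le_anti; rewrite cd dc.
Qed.

Lemma before_total c d : before c d || before d c.
Proof. by rewrite /before; case: ltngtP => //= _; apply: cell_le_total. Qed.

Lemma before_trans d c x : before c d -> before d x -> before c x.
Proof.
rewrite /before; case: (ltngtP (target d) (target c)) => //= [lt1 _|->].
  by case/orP => [/ltn_trans -> //|/andP[/eqP <- _]]; rewrite lt1.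
by move=> le1 /orP[-> //|/andP[-> /cell_le_trans/(_ le1) ->]]; exact: orbT.
Qed.

(** The entry of a cell is its rank for the total order [before]. The rank is at most the number of
    cells, so [inord] never falls back on its default. *)
Definition worst_filling : filling la :=
  [ffun c => inord #|[set d | before d c]|].

Lemma worst_fillingE c : worst_filling c = #|[set d | before d c]| :> nat.
Proof. by rewrite ffunE inordK // ltnS; apply: leq_trans (max_card _) _; rewrite card_cell. Qed.

Lemma worst_filling_leq c d : (worst_filling c <= worst_filling d) = before c d.
Proof.
have homo x y : before x y -> worst_filling x <= worst_filling y.
  move=> xy; rewrite !worst_fillingE; apply: subset_leq_card; apply/subsetP => z.
  by rewrite !inE => /before_trans; apply.
apply/idP/idP => [le_cd|]; last exact: homo.
have /orP[//|dc] := before_total c d.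
(* If [d] comes before [c], the initial segment of [d] lies in that of [c]; the assumed inequality
   of ranks makes them equal, so [c] is in the segment of [d]. *)
have sub : [set x | before x d] \subset [set x | before x c].
  by apply/subsetP => x; rewrite !inE => /before_trans; apply.
have /eqP/setP/(_ c) : [set x | before x d] == [set x | before x c].
  by rewrite eqEcard sub -!worst_fillingE.
by rewrite !inE before_refl.
Qed.

Lemma worst_filling_inj : injective worst_filling.
Proof.
by move=> c d E; apply: before_anti; rewrite -worst_filling_leq E.
Qed.

Lemma worst_filling_tableau : is_tableau worst_filling.
Proof.
apply/andP; split; first exact/injectiveP/worst_filling_inj.
rewrite eqEcard; apply/andP; split.
  apply/subsetP => _ /imsetP[c _ ->]; rewrite inE worst_fillingE.
  by apply/card_gt0P; exists c; rewrite inE before_refl.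
rewrite (card_imset _ worst_filling_inj) cardsT card_cell.
rewrite -[X in _ <= X](card_ord_interval (leqnn (sumn la))).
apply: subset_leq_card; apply/subsetP => k; rewrite !inE => ->.
by rewrite -ltnS ltn_ord.
Qed.

(** * Single rounds and the upper bound *)

Lemma step_cases T c : is_tableau T ->
  (next_cells c = set0 /\ step (T c) T = None) \/
  exists d, [/\ d \in next_cells c, forall z, z \in next_cells c -> T d <= T z &
    step (T c) T = if T d < T c then Some (exchange (T c) (T d) T) else None].
Proof.
case/andP=> /injectiveP injT _; rewrite /step.
have -> : [pick x | T x == T c] = Some c.
  by case: pickP => [x /eqP /injT -> //|/(_ c)]; rewrite eqxx.
case: pickP => [d0 d0c|nc]; [right | left].
  by case: arg_minnP => // d dc le_d; exists d.
by split=> //; apply/setP => x; rewrite in_set0; apply: nc.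
Qed.

Lemma exchange_cell T c d x : is_tableau T ->
  exchange (T c) (T d) T x = T (tperm c d x).
Proof. by case/andP=> /injectiveP injT _; rewrite ffunE inj_tperm. Qed.

Lemma exchange_cells_tableau T c d : is_tableau T ->
  is_tableau (exchange (T c) (T d) T).
Proof.
move=> tT; have T_gt0 x : 0 < T x.
  by case/andP: tT => _ /eqP imT; have := imset_f T (in_setT x); rewrite imT inE.
exact: exchange_tableau.
Qed.

(** Each exchange brings the moving entry to a neighbour of strictly smaller weight. *)
Lemma slide_count_leq f T c : is_tableau T -> (slide f (T c) T).2 <= w c.
Proof.
elim: f T c => [|f IH] T c tT //=.
have [[_ -> //]|[d [dc _ ->]]] := step_cases c tT.
case: ifP => // _.
have := IH _ d (exchange_cells_tableau c d tT).
rewrite exchange_cell // tpermR.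
by case: slide => T' e /= le_e; apply: leq_ltn_trans le_e (next_weight dc).
Qed.

Lemma slide_frame f T c x : is_tableau T -> ~~ dominated c x ->
  (slide f (T c) T).1 x = T x.
Proof.
elim: f T c => [|f IH] T c tT //= cx.
have [[_ -> //]|[d [dc _ ->]]] := step_cases c tT.
case: ifP => // _.
have dx : ~~ dominated d x.
  by apply: contra cx; apply: dominated_trans (next_dominated dc).
have := IH _ d (exchange_cells_tableau c d tT) dx.
rewrite !exchange_cell // tpermR tpermD; first by case: slide.
  by apply: contraNneq cx => ->; apply: dominated_refl.
by apply: contraNneq dx => ->; apply: dominated_refl.
Qed.

Local Notation processes := (sorted (fun c d => cell_le d c)).

(** A dominated cell is above [c] in [cell_le], hence is [c] itself or was processed earlier. *)
Lemma processes_dominated c s z : processes (c :: s) -> uniq (c :: s) ->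
  dominated c z -> z \notin s.
Proof.
rewrite /= path_sortedE; last by move=> x y u yx ux; apply: cell_le_trans ux yx.
case/andP=> /allP le_c _ /andP[cs _] cz; apply: contraNN cs => zs.
suff -> : c = z by [].
by apply: cell_le_anti; rewrite dominated_le // le_c.
Qed.

Definition nps_from T (S : filling la * nat) s : filling la * nat :=
  foldl (fun (S : filling la * nat) c =>
           let: (T', e) := slide #|{: cell la}| (T c) S.1 in (T', S.2 + e)) S s.

(** Rounds so far leave unprocessed cells untouched, so the entry read in the initial [T] is the one
    now sitting at the cell, and the bound for one slide applies. *)
Lemma nps_from_leq T U n s : processes s -> uniq s -> is_tableau U ->
  {in s, U =1 T} -> (nps_from T (U, n) s).2 <= n + \sum_(c <- s) w c.
Proof.
elim: s U n => [|c s IH] U n sorted_s uniq_s tU UT; first by rewrite big_nil addn0.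
rewrite /= big_cons addnA -(UT c) ?mem_head //.
have := slide_count_leq #|{: cell la}| c tU.
have := slide_tableau #|{: cell la}| (U c) tU.
have := @slide_frame #|{: cell la}| U c ^~ tU.
case: slide => U' e /= frame tU' le_e.
apply: leq_trans (IH _ _ (path_sorted sorted_s) _ tU' _) _.
- by case/andP: uniq_s.
- move=> x xs; rewrite frame ?UT ?inE ?xs ?orbT //.
  by apply/negP => /(processes_dominated sorted_s uniq_s); rewrite xs.
- by rewrite leq_add2r leq_add2l.
Qed.

(* [s] lists the cells not processed yet. *)
Definition keeps_target s U := forall y, y \notin s ->
  exists x, [/\ x \notin s, U y = worst_filling x & target x = target y].

(** * Attaining the bound *)

Section Partition.

Hypothesis hla : is_partition la.

(** Weakly decreasing parts make the diagram closed towards the north-west. *)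
Lemma cell_exists d i j : 0 < i <= row d -> 0 < j <= col d ->
  exists z, row z = i /\ col z = j.
Proof.
move=> /andP[i0 id] /andP[j0 jd]; have := valP d; rewrite /= -/(row d) -/(col d).
case/andP=> /andP[r0 rs] /andP[c0 cs].
have le_nth : nth 0 la (row d).-1 <= nth 0 la i.-1.
  have geq_trans : transitive geq by move=> x y z /= yx zy; apply: leq_trans zy yx.
  have geq_refl : reflexive geq by move=> x /=.
  case/andP: hla => /(sorted_leq_nth geq_trans geq_refl 0) nth_geq _.
  by apply: nth_geq; rewrite ?inE; lia.
have ilt : i < (size la).+1 by lia.
have jlt : j < (sumn la).+1 by have := ltn_ord (val d).2; rewrite -/(col d); lia.
have ij : in_diagram la (Ordinal ilt) (Ordinal jlt) by rewrite /in_diagram /=; lia.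
by exists (Sub (Ordinal ilt, Ordinal jlt) ij : cell la).
Qed.

Lemma next_towards c d : dominated c d -> c != d ->
  exists2 z, z \in next_cells c & dominated z d.
Proof.
move=> /andP[rr cc] neq; have [/andP[r0 _] /andP[c0 _]] := andP (valP c).
move: r0 c0; rewrite -/(row c) -/(col c) => r0 c0.
have [lt_r|ge_r] := ltnP (row c) (row d).
  have [||z [rz cz]] := @cell_exists d (row c).+1 (col c); try by lia.
  by exists z; rewrite ?inE /dominated rz cz ?eqxx ?lt_r.
have lt_c : col c < col d.
  rewrite ltn_neqAle cc andbT; apply: contraNneq neq => E.
  by apply/eqP/cell_inj => //; apply/eqP; rewrite eqn_leq rr.
have [||z [rz cz]] := @cell_exists d (row c) (col c).+1; try by lia.
by exists z; rewrite ?inE /dominated rz cz ?eqxx ?orbT ?lt_c ?rr.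
Qed.

(** One step towards the cell realising the target keeps that cell within reach. *)
Lemma next_same_target c : 0 < w c ->
  exists2 z, z \in next_cells c & target z = target c.
Proof.
have [d cd E] := target_key c; have Ew := w_target cd E => w_gt0.
have [|z zc zd] := next_towards cd.
  by apply: contraTneq w_gt0 => Ecd; move: Ew; rewrite Ecd; lia.
exists z => //; apply/eqP; rewrite eqn_leq target_dominated ?next_dominated //=.
by rewrite E; apply: leq_bigmax_cond.
Qed.

Lemma w_same_target c d : d \in next_cells c -> target d = target c ->
  w c = (w d).+1.
Proof.
move=> dc Et; have [x cx Ex] := target_key c; have [y dy Ey] := target_key d.
(* Injectivity of [key] turns equal targets into one common farthest cell; [d] is one step closer to
   it. *)
have Exy : x = y by apply: key_inj; rewrite -Ex -Ey.
have := w_target cx Ex; have := w_target dy Ey; rewrite Exy.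
by move: dc; rewrite inE; lia.
Qed.

(** Induction along the path of the entry that started at [c] and is now at [y]. The fuel bounds the
    cells on later antidiagonals, whose number drops at each exchange; when none is left, [w y] is
    0. *)
Lemma slide_worst f s c U y : is_tableau U -> U y = worst_filling c ->
  keeps_target s U -> dominated c y -> target y = target c ->
  (forall z, dominated c z -> z \notin s) ->
  (forall x, x \notin s -> cell_le c x) ->
  #|[set d : cell la | row y + col y < row d + col d]| <= f ->
  keeps_target s (slide f (U y) U).1 /\ (slide f (U y) U).2 = w y.
Proof.
move=> tU Uy keepU cy Ety; move=> dom_s le_s; elim: f U y tU Uy keepU cy Ety.
  move=> U y tU Uy keepU cy Ety; rewrite leqn0 cards_eq0 => /eqP E0; split => //=.
  apply/eqP; rewrite eq_sym eqn0Ngt; apply/negP => /next_same_target [z].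
  by move=> /next_rowcol lt_yz _; have := in_set0 z; rewrite -E0 inE lt_yz.
move=> f IH U y tU Uy keepU cy Ety le_f /=.
have [[E0 ->]|[d [dy min_d ->]]] := step_cases y tU.
  split => //=; apply/eqP; rewrite eq_sym eqn0Ngt; apply/negP.
  by case/next_same_target=> z; rewrite E0 inE.
have cd : dominated c d := dominated_trans cy (next_dominated dy).
have [z zy Etz] : exists2 z, z \in next_cells y & target z = target y.
  apply: next_same_target.
  by have := next_weight dy; apply: leq_trans.
have [x [xs Ux Etx]] := keepU d (dom_s d cd).
have [x0 [x0s Ux0 Etx0]] := keepU z (dom_s z (dominated_trans cy (next_dominated zy))).
(* The entry at [d] is at most the one at [z], and smaller entries come from larger targets, so
   [target d] is at least [target z], which is [target y]. *)
have Etd : target d = target y.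
  apply/eqP; rewrite eqn_leq target_dominated ?next_dominated //=.
  have := min_d z zy; rewrite Ux Ux0 worst_filling_leq /before Etx Etx0 Etz.
  by case/orP => [/ltnW //|/andP[/eqP -> _]].
(* Both entries come from cells with the same target, and [c], the least processed cell in
   [cell_le], holds the largest entry among those. *)
have lt_d : U d < U y.
  rewrite ltn_neqAle; apply/andP; split.
    case/andP: tU => /injectiveP injU _.
    by rewrite (inj_eq val_inj) (inj_eq injU) next_neq.
  by rewrite Ux Uy worst_filling_leq /before Etx Etd Ety eqxx le_s ?orbT.
rewrite lt_d.
have tU' := exchange_cells_tableau y d tU.
have U'd : exchange (U y) (U d) U d = U y by rewrite exchange_cell // tpermR.
(* The exchanged cells [y] and [d] share their target, so swapping their entries preserves the
   invariant. *)
have keepU' : keeps_target s (exchange (U y) (U d) U).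
  move=> u us; rewrite exchange_cell //; case: tpermP => [->|->|_ _].
  - by exists x; rewrite Etx.
  - have [v [vs Uv Etv]] := keepU y (dom_s y cy).
    by exists v; rewrite Etv Etd.
  - exact: keepU.
have := IH _ d tU' _ keepU' cd; rewrite U'd Etd => /(_ Uy Ety).
case: slide => U' e /= [].
  rewrite -ltnS; apply: leq_trans le_f; apply: proper_card.
  have lt_yd := next_rowcol dy; apply/properP; split.
    by apply/subsetP => u; rewrite !inE; apply: ltn_trans.
  by exists d; rewrite !inE ?ltnn.
by move=> keepU'' ->; split=> //; rewrite (w_same_target dy).
Qed.

Lemma nps_from_worst U n s : processes s -> uniq s ->
  (forall x y, x \in s -> y \notin s -> cell_le x y) -> is_tableau U ->
  {in s, U =1 worst_filling} -> keeps_target s U ->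
  (nps_from worst_filling (U, n) s).2 = n + \sum_(c <- s) w c.
Proof.
elim: s U n => [|c s IH] U n sorted_s uniq_s le_s tU UT keepU.
  by rewrite big_nil addn0.
have dom_s z : dominated c z -> z \notin s by apply: processes_dominated.
have c_le x : x \notin s -> cell_le c x.
  move=> xs; have [->|xc] := eqVneq x c; first exact: cell_le_refl.
  by apply: le_s; rewrite ?mem_head // inE negb_or xc.
(* Moving [c] to the processed cells is harmless: it still holds its own initial entry. *)
have keepU' : keeps_target s U.
  move=> y ys; have [->|yc] := eqVneq y c.
    by exists c; rewrite dom_s ?dominated_refl // UT ?mem_head.
  have [|x [xs Ux Etx]] := keepU y; first by rewrite inE negb_or yc.
  by exists x; move: xs; rewrite inE negb_or => /andP[].
rewrite /= big_cons addnA -(UT c) ?mem_head //.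
have := slide_worst tU (UT c (mem_head _ _)) keepU' (dominated_refl c) erefl
          dom_s c_le (max_card _).
have := slide_tableau #|{: cell la}| (U c) tU.
have := @slide_frame #|{: cell la}| U c ^~ tU.
case: slide => U' e /= frame tU' [keepU'' ->].
apply: IH (path_sorted sorted_s) _ _ tU' _ keepU''.
- by case/andP: uniq_s.
- move=> x y xs ys; apply: cell_le_trans (c_le y ys).
  move: sorted_s; rewrite /= path_sortedE; last first.
    by move=> ? ? ? yx ux; apply: cell_le_trans ux yx.
  by case/andP => /allP/(_ x xs).
- move=> x xs; rewrite frame ?UT ?inE ?xs ?orbT //.
  by apply/negP => /dom_s; rewrite xs.
Qed.

End Partition.

End Cells.

Theorem proposition3p1 (la : seq nat) (hla : is_partition la) :
  worst_case la = \sum_(c : cell la) w c.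
Proof.
have sorted_cells : sorted (fun c d => cell_le d c) (cells_decreasing la).
  by apply: sort_sorted => c d; apply: cell_le_total.
have uniq_cells : uniq (cells_decreasing la) by rewrite sort_uniq enum_uniq.
have mem_cells c : c \in cells_decreasing la by rewrite mem_sort mem_enum.
have <- : \sum_(c <- cells_decreasing la) w c = \sum_(c : cell la) w c.
  by rewrite -big_enum; apply: perm_big; rewrite perm_sort.
apply/eqP; rewrite eqn_leq; apply/andP; split.
  by apply/bigmax_leqP => T tT; apply: (@nps_from_leq la T T 0).
(* Initially every cell is unprocessed, so the invariant and the order condition on processed cells
   hold vacuously. *)
rewrite -[X in X <= _](@nps_from_worst la hla (worst_filling la) 0) //.
- exact/leq_bigmax_cond/worst_filling_tableau.
- by move=> c d _; rewrite mem_cells.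
- exact: worst_filling_tableau.
- by move=> c; rewrite mem_cells.
Qed.
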